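(* Let $H$ be a hypergraph. If $H$ contains no singleton hyperedge, then $b_L^o(H)=b_L(H)$. Further, $b_L^o(\mathrm{core}(H))=b_L(H)$.
   Context: A hypergraph $H$ consists of a finite vertex set $V(H)$ and a finite collection $E(H)$ of nonempty subsets of $V(H)$. Lazy burning: a set $B\subseteq V(H)$ is burned initially; in each subsequent round every unburned vertex $v$ for which some hyperedge $h\ni v$ has $h\setminus\{v\}$ entirely burned becomes burned (so vertices of singleton hyperedges burn immediately); $b_L(H)$ is the minimum size of an initial set that eventually burns all vertices. Lazy burning without spontaneous burning is the same process except that $v$ burns only if there is a hyperedge $h\ni v$ with $|h|\ge2$ and $h\setminus\{v\}$ entirely burned; $b_L^o(H)$ is the corresponding minimum. For $U\subseteq V(H)$, $H[U]$ has vertex set $U$ and hyperedges $\{h\cap U: h\in E(H),\ h\cap U\neq\emptyset\}$. The core $\mathrm{core}(H)$ is $H[U]$ for the largest $U\subseteq V(H)$ such that every hyperedge of $H[U]$ has cardinality at least $2$. *)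

(* Defs.v *)
From HB Require Import structures.
From mathcomp Require Import all_boot.

Set Implicit Arguments.
Unset Strict Implicit.
Unset Printing Implicit Defensive.

(* The vertex set is a subset of an ambient finite type, so that a hypergraph
   and its induced subhypergraphs live over the same type. *)
Record hypergraph (T : finType) := Hypergraph {
  vertices : {set T};
  hyperedges : {set {set T}};
  hyperedge_sub : forall h, h \in hyperedges -> h \subset vertices;
  hyperedge_neq0 : forall h, h \in hyperedges -> h != set0
}.

Section LazyBurning.

Variables (T : finType) (H : hypergraph T).
Implicit Types (ok : pred {set T}) (B S : {set T}).

(* One round, in which only the hyperedges satisfying [ok] propagate fire. *)
Definition burn_round ok S : {set T} :=
  S :|: [set v in vertices H |
          [exists h in hyperedges H, [&& ok h, v \in h & h :\ v \subset S]]].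

Definition burned_after ok B n : {set T} := iter n (burn_round ok) B.

(* The burned set is stationary after #|T| rounds, so the bound on the number
   of rounds only serves to make the predicate boolean; see burns_allP. *)
Definition burns_all ok B : bool :=
  [exists n : 'I_#|T|.+1, vertices H \subset burned_after ok B n].

Definition burning_number ok : nat :=
  #|[arg min_(B < vertices H | (B \subset vertices H) && burns_all ok B) #|B|]|.

Definition bL : nat := burning_number predT.

Definition bLo : nat := burning_number [pred h : {set T} | 2 <= #|h|].

Lemma burned_afterS ok B n : burned_after ok B n \subset burned_after ok B n.+1.
Proof. exact: subsetUl. Qed.

Lemma burned_after_mono ok B m n :
  m <= n -> burned_after ok B m \subset burned_after ok B n.
Proof.
move=> /subnK <-; elim: (n - m) => [|k IHk]; first by rewrite add0n.
by rewrite addSn (subset_trans IHk) ?burned_afterS.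
Qed.

Lemma burned_after_stable ok B n :
  burned_after ok B n \subset burned_after ok B #|T|.
Proof.
have grow k : (exists2 j, j <= k & burned_after ok B j.+1 = burned_after ok B j)
              \/ k < #|burned_after ok B k.+1|.
  elim: k => [|k [[j le_jk ej] | lt_k]].
  - have [e | ne] := eqVneq (burned_after ok B 1) (burned_after ok B 0).
      by left; exists 0.
    right; apply: leq_ltn_trans (proper_card (_ : burned_after ok B 0 \proper _)).
      exact: leq0n.
    by rewrite properEneq eq_sym ne burned_afterS.
  - by left; exists j => //; apply: leqW.
  - have [e | ne] := eqVneq (burned_after ok B k.+2) (burned_after ok B k.+1).
      by left; exists k.+1.
    right; apply: leq_ltn_trans (proper_card (_ : burned_after ok B k.+1 \proper _)).
      exact: lt_k.
    by rewrite properEneq eq_sym ne burned_afterS.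
have [[j le_jT ej] | ] := grow #|T|; last by rewrite ltnNge max_card.
have stat i : burned_after ok B (i + j) = burned_after ok B j.
  by elim: i => // i; rewrite addSn {2}/burned_after /= -/(burned_after _ _ _) => ->.
have [le_nj | /ltnW/subnK <-] := leqP n j.
  exact: subset_trans (burned_after_mono _ _ le_nj) (burned_after_mono _ _ le_jT).
by rewrite stat burned_after_mono.
Qed.

Lemma burns_allP ok B :
  reflect (exists n, vertices H \subset burned_after ok B n) (burns_all ok B).
Proof.
apply: (iffP existsP) => [[n Vn] | [n Vn]]; first by exists n.
by exists ord_max; apply: subset_trans Vn (burned_after_stable _ _ _).
Qed.

Lemma burning_number_witness ok :
  exists B, [/\ B \subset vertices H,
                exists n, vertices H \subset burned_after ok B n
              & #|B| = burning_number ok].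
Proof.
rewrite /burning_number; case: arg_minnP => [|B /andP[sBV /burns_allP VB] _].
  by rewrite subxx; apply/burns_allP; exists 0; rewrite subxx.
by exists B.
Qed.

Lemma burning_number_min ok B n :
    B \subset vertices H -> vertices H \subset burned_after ok B n ->
  burning_number ok <= #|B|.
Proof.
move=> sBV VB; rewrite /burning_number; case: arg_minnP => [|A _ -> //].
  by rewrite subxx; apply/burns_allP; exists 0; rewrite subxx.
by rewrite sBV; apply/burns_allP; exists n.
Qed.

End LazyBurning.

Section Core.

Variables (T : finType) (H : hypergraph T).
Implicit Types U : {set T}.

Definition induced_hyperedges U : {set {set T}} :=
  [set h :&: U | h in hyperedges H & h :&: U != set0].

Lemma induced_hyperedge_sub U h : h \in induced_hyperedges U -> h \subset U.
Proof. by case/imsetP=> e _ ->; apply: subsetIr. Qed.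

Lemma induced_hyperedge_neq0 U h : h \in induced_hyperedges U -> h != set0.
Proof. by case/imsetP=> e /[!inE] /andP[_ ne0] ->. Qed.

(* Only meaningful for U \subset vertices H. *)
Definition induced U : hypergraph T :=
  Hypergraph (@induced_hyperedge_sub U) (@induced_hyperedge_neq0 U).

Definition core_cond U : bool :=
  (U \subset vertices H) && [forall h in hyperedges (induced U), 2 <= #|h|].

Definition core_vertices : {set T} := [arg max_(U > set0 | core_cond U) #|U|].

Definition core : hypergraph T := induced core_vertices.

Lemma core_cond0 : core_cond set0.
Proof.
rewrite /core_cond sub0set; apply/forall_inP => h /imsetP[e].
by rewrite !inE setI0 eqxx andbF.
Qed.

Lemma core_condU U1 U2 : core_cond U1 -> core_cond U2 -> core_cond (U1 :|: U2).
Proof.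
move=> /andP[sU1 /forall_inP c1] /andP[sU2 /forall_inP c2].
rewrite /core_cond subUset sU1 sU2; apply/forall_inP => _ /imsetP[e + ->].
rewrite inE => /andP[eH]; rewrite setIUr setU_eq0 negb_and => /orP[] ne0.
- apply: leq_trans (subset_leq_card (subsetUl _ _)).
  by apply: c1; apply: imset_f; rewrite inE eH.
- apply: leq_trans (subset_leq_card (subsetUr _ _)).
  by apply: c2; apply: imset_f; rewrite inE eH.
Qed.

Lemma core_vertices_cond : core_cond core_vertices.
Proof. by rewrite /core_vertices; case: arg_maxnP; first exact: core_cond0. Qed.

(* [core_vertices] is also the largest for inclusion, hence unique. *)
Lemma core_vertices_max U : core_cond U -> U \subset core_vertices.
Proof.
rewrite /core_vertices; case: arg_maxnP => [|M cM maxM cU].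
  exact: core_cond0.
have /eqP -> : M == M :|: U.
  by rewrite eqEcard subsetUl; apply: maxM; apply: core_condU.
exact: subsetUr.
Qed.

End Core.

(* Main.v *)
Require Import Defs.
From HB Require Import structures.
From mathcomp Require Import all_boot.

Set Implicit Arguments.
Unset Strict Implicit.
Unset Printing Implicit Defensive.

(** The vertices that burn with no initial fire contain the complement of the
    core: a hyperedge meeting the unburned vertices in a single vertex would
    propagate to it.  Hence a fire in [core H] can be replayed in [H], where the
    removed parts of the hyperedges are already burned.  Conversely, a fire in
    [H] started at [B] restricts to a fire in [core H] started at the trace of
    [B], without spontaneous burning since the hyperedges of the core have at
    least two elements. *)

Section BurnClosure.

Variables (T : finType) (H : hypergraph T).
Implicit Types (ok : pred {set T}) (B F : {set T}).

(** Closed sets replace the counting of rounds: what [B] eventually burns is the smallest closed set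
    containing [B]. *)
Definition burn_closed ok F : Prop :=
  forall h v, h \in hyperedges H -> ok h -> v \in h -> h :\ v \subset F ->
  v \in F.

Lemma burned_after_min ok B F n :
  B \subset F -> burn_closed ok F -> burned_after H ok B n \subset F.
Proof.
move=> sBF clF; elim: n => // n IHn; rewrite /= subUset IHn; apply/subsetP=> v.
rewrite inE => /andP[_ /exists_inP[h hH /and3P[okh vh sh]]].
exact: clF _ _ hH okh vh (subset_trans sh IHn).
Qed.

Lemma burned_after_closed ok B : burn_closed ok (burned_after H ok B #|T|).
Proof.
(* A round beyond [#|T|] burns nothing new, so it is enough that [v] burns in that extra round. *)
move=> h v hH okh vh sh; apply: (subsetP (burned_after_stable H ok B #|T|.+1)).
rewrite /= !inE (subsetP (hyperedge_sub hH)) //=; apply/orP; right.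
by apply/exists_inP; exists h; rewrite // okh vh.
Qed.

Lemma burning_number_le_closed ok B :
    B \subset vertices H ->
    (forall F, B \subset F -> burn_closed ok F -> vertices H \subset F) ->
  burning_number H ok <= #|B|.
Proof.
move=> sBV clV; apply: (burning_number_min (n := #|T|)) sBV _.
by apply: clV; [apply: (burned_after_stable H ok B 0) | apply: burned_after_closed].
Qed.

Lemma burning_number_closed_witness ok :
  exists B, [/\ B \subset vertices H, #|B| = burning_number H ok
    & forall F, B \subset F -> burn_closed ok F -> vertices H \subset F].
Proof.
have [B [sBV [n VB] cB]] := burning_number_witness H ok.
exists B; split=> // F sBF clF.
exact: subset_trans VB (burned_after_min n sBF clF).
Qed.

Lemma burning_number_le ok1 ok2 :
    (forall F, burn_closed ok1 F -> burn_closed ok2 F) ->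
  burning_number H ok1 <= burning_number H ok2.
Proof.
move=> cl12; have [B [sBV <- VB]] := burning_number_closed_witness ok2.
by apply: burning_number_le_closed => // F sBF /cl12; apply: VB.
Qed.

Lemma bLo_no_singleton :
  (forall h, h \in hyperedges H -> #|h| <> 1) -> bLo H = bL H.
Proof.
move=> no1; apply/eqP; rewrite eqn_leq; apply/andP; split.
- apply: burning_number_le => F clF h v hH _; apply: clF => //=.
  rewrite ltn_neqAle card_gt0 (hyperedge_neq0 hH) andbT eq_sym.
  exact/eqP/no1.
- by apply: burning_number_le => F clF h v hH _; apply: clF.
Qed.

End BurnClosure.

Section BurnCore.

Variables (T : finType) (H : hypergraph T).
Implicit Types F : {set T}.

Let U := core_vertices H.

Lemma core_vertices_sub : U \subset vertices H.
Proof. by have /andP[] := core_vertices_cond H. Qed.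

Lemma core_hyperedge h v :
    h \in hyperedges H -> v \in h -> v \in U ->
  h :&: U \in hyperedges (core H) /\ 1 < #|h :&: U|.
Proof.
move=> hH vh vU; have hUc : h :&: U \in hyperedges (core H).
  by apply: imset_f; rewrite inE hH; apply/set0Pn; exists v; rewrite inE vh.
by split=> //; have /andP[_ /forall_inP] := core_vertices_cond H; apply.
Qed.

(** By maximality of the core, it suffices that no hyperedge meets the unburned set in exactly one
    vertex; closedness would put that vertex in [F]. *)
Lemma burn_closed_setD_core F :
  burn_closed H predT F -> vertices H :\: F \subset U.
Proof.
move=> clF; apply: core_vertices_max; rewrite /core_cond subsetDl.
apply/forall_inP=> _ /imsetP[h + ->]; rewrite inE => /andP[hH ne0].
rewrite ltn_neqAle card_gt0 ne0 andbT eq_sym; apply/negP => /cards1P[v hv].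
have /setIP[vh /setDP[_ /negP[]]] : v \in h :&: (vertices H :\: F).
  by rewrite hv set11.
apply: (clF _ _ hH _ vh) => //; apply/subsetP=> w /setD1P[nwv wh].
apply: contraNT nwv => nwF; rewrite -in_set1 -hv !inE wh nwF.
exact: (subsetP (hyperedge_sub hH)).
Qed.

(** Passing to the trace [h :&: U] forgets only vertices outside the core, and these already lie in
    [F]. *)
Lemma burn_closed_core F :
  burn_closed H predT F -> burn_closed (core H) [pred h : {set T} | 1 < #|h|] F.
Proof.
move=> clF _ v /imsetP[h + ->] _; rewrite inE => /andP[hH _] /setIP[vh vU] sh.
apply: (clF _ _ hH _ vh) => //; apply/subsetP=> w /setD1P[nwv wh].
have [wU | nwU] := boolP (w \in U); first by apply: (subsetP sh); rewrite !inE nwv wh.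
apply: contraNT nwU => nwF; apply: (subsetP (burn_closed_setD_core clF)).
by rewrite inE nwF (subsetP (hyperedge_sub hH)).
Qed.

(** Adding [~: U] settles every [v] outside [U]. For [v] in [U], the trace of [h] is a core
    hyperedge with at least two elements, so it may propagate in the core. *)
Lemma burn_closed_core_ext F :
    burn_closed (core H) [pred h : {set T} | 1 < #|h|] F ->
  burn_closed H predT (F :|: ~: U).
Proof.
move=> clF h v hH _ vh sh; rewrite !inE orbC -implybE; apply/implyP=> vU.
have [hUc hU2] := core_hyperedge hH vh vU.
apply: (clF _ _ hUc hU2); first by rewrite inE vh.
apply/subsetP=> w /setD1P[nwv /setIP[wh wU]].
have /(subsetP sh) : w \in h :\ v by rewrite !inE nwv.
by rewrite !inE wU orbF.
Qed.

Lemma bLo_core : bLo (core H) = bL H.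
Proof.
apply/eqP; rewrite eqn_leq; apply/andP; split.
- have [B [_ cB VB]] := burning_number_closed_witness H predT.
  rewrite /bL -cB; apply: leq_trans (subset_leq_card (subsetIl B U)).
  apply: burning_number_le_closed => [|F sBF clF]; first exact: subsetIr.
  (* [F :|: ~: U] is closed in [H] and contains [B], since [B :&: U] lies in [F]. *)
  have sUF : U \subset F :|: ~: U.
    apply: subset_trans core_vertices_sub (VB _ _ (burn_closed_core_ext clF)).
    by rewrite setUC -subDset setDE setCK.
  by rewrite -[F]setU0 -(setICr U) setUIr subsetI sUF andbC subsetUr.
- have [B [sBU cB VB]] := burning_number_closed_witness (core H)
                            [pred h : {set T} | 1 < #|h|].
  rewrite /bLo -cB; apply: burning_number_le_closed => [|F sBF clF].
    exact: subset_trans sBU core_vertices_sub.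
  have sUF : U \subset F by apply: VB => //; apply: burn_closed_core.
  (* A vertex of [H] outside [F] would lie in the core, which [F] contains. *)
  apply/subsetP=> v vV; apply/negPn/negP=> nvF; case/negP: (nvF).
  apply/(subsetP sUF)/(subsetP (burn_closed_setD_core clF)).
  by rewrite inE nvF.
Qed.

End BurnCore.

Theorem theorem4p2 (T : finType) (H : hypergraph T) :
  ((forall h : {set T}, h \in hyperedges H -> #|h| <> 1) -> bLo H = bL H) /\
  bLo (core H) = bL H.
Proof. by split; [apply: bLo_no_singleton | apply: bLo_core]. Qed.
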